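(* Let $k$ be a field, let $d\geq 2$, and let $V_d$ be a $d$-dimensional $k$-vector space. Then $\dim_k(\Lambda_{V_d}^{S^2}[2d])\geq 1$.
   Context: For $n\geq 0$ set $\mathcal{T}^{S^2}_{V_d}[n]=V_d^{\otimes \frac{n(n-1)}{2}}$, with tensor factors indexed by the pairs $(i,j)$, $1\leq i<j\leq n$, and write $\otimes_{1\leq i<j\leq n}(v_{i,j})$ for the simple tensor with entry $v_{i,j}\in V_d$ in the factor indexed by $(i,j)$. Let $\mathcal{E}^{S^2}_{V_d}[n]$ be the subspace of $\mathcal{T}^{S^2}_{V_d}[n]$ generated by those elements $\otimes_{1\leq i<j\leq n}(v_{i,j})$ for which there exist $1\leq x<y<z\leq n$ such that $v_{x,y}=v_{x,z}=v_{y,z}$. Define the quotient vector space $$\Lambda_{V_d}^{S^2}[n]=\frac{\mathcal{T}^{S^2}_{V_d}[n]}{\mathcal{E}^{S^2}_{V_d}[n]}.$$ *)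

(* Defs.v *)
From HB Require Import structures.
From mathcomp Require Import all_boot all_algebra boolp.

Set Implicit Arguments.
Unset Strict Implicit.
Unset Printing Implicit Defensive.

Import GRing.Theory.
Local Open Scope ring_scope.
Local Open Scope quotient_scope.

Section VQuotient.
Import passmx.
Variables (k : fieldType) (V : vectType k) (U : {vspace V}).

Definition vquot : Type := @Quotient.quot V (pred_of_vspace U).

HB.instance Definition _ := GRing.Zmodule.on vquot.

Definition vproj (v : V) : vquot := \pi_(@Quotient.quot V (pred_of_vspace U)) v.

Definition vrepr (q : vquot) : V :=
  repr (q : @Quotient.quot V (pred_of_vspace U)).

Lemma vreprK : cancel vrepr vproj.
Proof. by move=> q; rewrite /vproj /vrepr reprK. Qed.

Lemma vproj_eq u v : (vproj u == vproj v) = (u - v \in U).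
Proof. by rewrite /vproj -Quotient.idealrBE. Qed.

Lemma vprojD : {morph vproj : u v / u + v}.
Proof. by move=> u v; rewrite /vproj [LHS]raddfD. Qed.

Lemma vreprB v : vrepr (vproj v) - v \in U.
Proof. by rewrite -vproj_eq vreprK. Qed.

Definition vquot_scale (a : k) (q : vquot) : vquot := vproj (a *: vrepr q).

Lemma vproj_scale a v : vquot_scale a (vproj v) = vproj (a *: v).
Proof. by apply/eqP; rewrite vproj_eq -scalerBr memvZ ?vreprB. Qed.

Fact vquot_scalerA a b q :
  vquot_scale a (vquot_scale b q) = vquot_scale (a * b) q.
Proof. by rewrite -[q]vreprK !vproj_scale scalerA. Qed.

Fact vquot_scale1r : left_id 1 vquot_scale.
Proof. by move=> q; rewrite -[q]vreprK vproj_scale scale1r. Qed.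

Fact vquot_scalerDr : right_distributive vquot_scale +%R.
Proof.
move=> a p q; rewrite -[p]vreprK -[q]vreprK -vprojD !vproj_scale.
by rewrite scalerDr vprojD.
Qed.

Fact vquot_scalerDl q : {morph vquot_scale^~ q : a b / a + b}.
Proof.
by move=> a b; rewrite -[q]vreprK !vproj_scale scalerDl vprojD.
Qed.

HB.instance Definition _ := GRing.Zmodule_isLmodule.Build k vquot
  vquot_scalerA vquot_scale1r vquot_scalerDr vquot_scalerDl.

Fact vproj_is_linear : linear vproj.
Proof. by move=> a u v; rewrite vprojD -vproj_scale. Qed.

HB.instance Definition _ := GRing.isLinear.Build k V vquot _ vproj
  vproj_is_linear.

Let C := (U^C)%VS.
Let toC (q : vquot) : subvs_of C := vsproj C (daddv_pi C U (vrepr q)).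
Let ofC (c : subvs_of C) : vquot := vproj (vsval c).

Let capCU : (C :&: U = 0)%VS. Proof. by rewrite capvC capv_compl. Qed.

Let addCU v : v \in (C + U)%VS.
Proof. by rewrite addvC addv_complf memvf. Qed.

Let pi_eq0 v : v \in U -> daddv_pi C U v = 0.
Proof.
move=> Uv; have := daddv_pi_add capCU (addCU v).
rewrite [X in _ + X](daddv_pi_id (capv_compl U)) //.
by move/(canRL (addrK v)); rewrite subrr.
Qed.

Let pi_vrepr v : daddv_pi C U (vrepr (vproj v)) = daddv_pi C U v.
Proof. by apply/eqP; rewrite -subr_eq0 -linearB /= pi_eq0 ?vreprB. Qed.

Let toCK : cancel toC ofC.
Proof.
move=> q; rewrite /toC /ofC vsprojK ?memv_pi // -[RHS]vreprK.
apply/eqP; rewrite vproj_eq -{2}(daddv_pi_add capCU (addCU (vrepr q))).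
by rewrite opprD addrA subrr add0r memvN memv_pi.
Qed.

Let ofCK : cancel ofC toC.
Proof.
by move=> c; rewrite /toC /ofC pi_vrepr daddv_pi_id ?subvsP ?vsvalK.
Qed.

Let toC_linear : linear toC.
Proof.
move=> a p q; rewrite -[p]vreprK -[q]vreprK -linearP /toC !pi_vrepr.
by rewrite !linearP.
Qed.

Fact vquot_vect_axiom : Vector.axiom (\dim {: subvs_of C}) vquot.
Proof.
have eB : basis_of {: subvs_of C} (vbasis {: subvs_of C}) by exact: vbasisP.
exists (rVof (vbasis {: subvs_of C}) \o toC).
  by move=> a p q /=; rewrite toC_linear linearP.
apply: bij_comp; last by exists ofC.
by exists (vecof (vbasis {: subvs_of C})); [exact: rVofK | exact: vecofK].
Qed.

HB.instance Definition _ := Lmodule_hasFinDim.Build k vquot vquot_vect_axiom.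

Lemma dim_vquot : (\dim {: vquot} + \dim U = \dim {: V})%N.
Proof.
have -> : \dim {: vquot} = \dim C.
  by rewrite dimvf [LHS]dimvf.
by rewrite dimv_compl subnK ?dimvS ?subvf.
Qed.

End VQuotient.

Section Generated.
Variables (k : fieldType) (V : vectType k).

Definition is_generated (P : V -> Prop) (U : {vspace V}) : Prop :=
  (forall v, P v -> v \in U) /\
  (forall W : {vspace V}, (forall v, P v -> v \in W) -> (U <= W)%VS).

Lemma is_generated_ex (P : V -> Prop) : exists U, is_generated P U.
Proof.
suff [s Ps max_s] : exists2 s : seq V, (forall v, v \in s -> P v) &
    forall v, P v -> v \in <<s>>%VS.
  exists <<s>>%VS; split=> // W PW.
  by apply/span_subvP => v /Ps/PW.
apply: contrapT => noS.
suff grow n : exists2 s : seq V, (forall v, v \in s -> P v) &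
    (n <= \dim <<s>>)%N.
  have [s _] := grow (\dim {:V}).+1.
  by rewrite ltnNge dimvS ?subvf.
elim: n => [|n [s Ps le_ns]]; first by exists [::].
have [v Pv sv] : exists2 v, P v & v \notin <<s>>%VS.
  apply: contrapT => nov; apply: noS; exists s => // v Pv.
  by apply/negPn/negP => sv; apply: nov; exists v.
exists (v :: s) => [w|]; first by rewrite inE => /predU1P[->|/Ps].
apply: leq_ltn_trans le_ns _; rewrite span_cons addvC.
rewrite (ltn_leqif (dimv_leqif_eq (addvSl _ _))).
apply: contra sv => /eqP ->.
by apply: subvP (addvSr _ _) _ _; rewrite memv_line.
Qed.

(* The least subspace containing P, unique by is_generated; the choice operator
   is only needed because P is neither finite nor decidable. *)
Definition generated (P : V -> Prop) : {vspace V} :=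
  projT1 (cid (is_generated_ex P)).

Lemma generatedP P : is_generated P (generated P).
Proof. exact: projT2 (cid (is_generated_ex P)). Qed.

End Generated.

Section TensorPower.
Variables (k : fieldType) (V : vectType k) (I : finType).

(* A tensor is given by its coordinates on the basis
   (e_{f i1} (x) e_{f i2} (x) ...)_f, where e is the basis vbasis {:V} and f
   runs over the maps I -> {0, ..., dim V - 1}. By tens_multilinear and
   tens_universal this is the tensor power, whatever the basis. *)
Definition tpow : Type := {ffun {ffun I -> 'I_(\dim {:V})} -> k^o}.

HB.instance Definition _ := Vector.on tpow.

Definition tens (v : {ffun I -> V}) : tpow :=
  [ffun f : {ffun I -> 'I_(\dim {:V})} =>
    \prod_i coord (vbasis {:V}) (f i) (v i)].

Lemma dim_tpow : \dim {: tpow} = (\dim {:V} ^ #|I|)%N.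
Proof. by rewrite [LHS]dimvf /= /dim /= muln1 card_ffun card_ord. Qed.

Definition upd (T : Type) (v : {ffun I -> T}) (i : I) (u : T) : {ffun I -> T} :=
  [ffun j => if j == i then u else v j].

Definition multilinear (W : lmodType k) (f : {ffun I -> V} -> W) : Prop :=
  forall (v : {ffun I -> V}) (i : I) (a : k) (u w : V),
    f (upd v i (a *: u + w)) = a *: f (upd v i u) + f (upd v i w).

Lemma tens_multilinear : multilinear tens.
Proof.
move=> v i a u w; apply/ffunP=> f; rewrite !ffunE.
have E x : \prod_j coord (vbasis {:V}) (f j) (upd v i x j) =
    coord (vbasis {:V}) (f i) x *
    \prod_(j | j != i) coord (vbasis {:V}) (f j) (v j).
  rewrite (bigD1 i) //= ffunE eqxx; congr (_ * _).
  by apply: eq_bigr => j /negPf ji; rewrite ffunE ji.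
by rewrite !E linearP mulrDl -mulrA.
Qed.

Let bas (f : {ffun I -> 'I_(\dim {:V})}) : {ffun I -> V} :=
  [ffun i => (vbasis {:V})`_(f i)].

Lemma multilinear_sum (W : lmodType k) (f : {ffun I -> V} -> W) :
  multilinear f -> forall v i n (c : 'I_n -> k) (b : 'I_n -> V),
  f (upd v i (\sum_(j < n) c j *: b j)) = \sum_(j < n) c j *: f (upd v i (b j)).
Proof.
move=> fM v i; elim=> [|n IHn] c b.
  rewrite !big_ord0; have := fM v i (-1) 0 0.
  by rewrite scaler0 addr0 scaleN1r addNr.
by rewrite !big_ord_recl fM IHn.
Qed.

Lemma multilinear_ext (W : lmodType k) (f g : {ffun I -> V} -> W) :
  multilinear f -> multilinear g -> (forall h, f (bas h) = g (bas h)) ->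
  forall v, f v = g v.
Proof.
move=> fM gM fg v.
suff H (s : seq I) : forall v : {ffun I -> V},
    (forall i, i \notin s -> exists j : 'I_(\dim {:V}),
        v i = (vbasis {:V})`_j) -> f v = g v.
  by apply: (H (enum I)) => i; rewrite mem_enum.
elim: s => [|i s IHs] {}v vb.
  have vb' i : {j : 'I_(\dim {:V}) | v i = (vbasis {:V})`_j}.
    by apply: cid; apply: vb.
  suff -> : v = bas [ffun i => projT1 (vb' i)] by [].
  by apply/ffunP => i; rewrite !ffunE; case: (vb' i).
have -> : v = upd v i (\sum_j coord (vbasis {:V}) j (v i) *: (vbasis {:V})`_j).
  rewrite -coord_vbasis ?memvf //.
  by apply/ffunP => j; rewrite ffunE; case: eqP => [->|].
rewrite !multilinear_sum //; apply: eq_bigr => j _; congr (_ *: _).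
apply: IHs => l ls; rewrite ffunE; case: eqP => [_|/eqP li]; first by exists j.
by apply: vb; rewrite inE negb_or li.
Qed.

Lemma tens_bas h : tens (bas h) = [ffun h' => (h' == h)%:R].
Proof.
apply/ffunP => h'; rewrite !ffunE.
have [->|nhh] := eqVneq h' h.
  by rewrite big1 // => i _; rewrite ffunE coord_free ?eqxx
    ?(basis_free (vbasisP _)).
have [i nhi] : exists i, h' i != h i.
  apply/existsP; apply: contraNT nhh; rewrite negb_exists => /forallP E.
  by apply/eqP/ffunP => i; apply/eqP/negPn/E.
rewrite (bigD1 i) //= ffunE coord_free ?(basis_free (vbasisP _)) //.
by rewrite eq_sym (negPf nhi) mul0r.
Qed.

Lemma tpow_decomp (t : tpow) : t = \sum_h t h *: tens (bas h).
Proof.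
apply/ffunP => h; rewrite sum_ffunE (bigD1 h) //= big1 => [|h' hh].
  by rewrite tens_bas !ffunE eqxx addr0 /GRing.scale /= mulr1.
by rewrite tens_bas !ffunE eq_sym (negPf hh) scaler0.
Qed.

Theorem tens_universal (W : lmodType k) (f : {ffun I -> V} -> W) :
  multilinear f ->
  (exists g : {linear tpow -> W}, forall v, g (tens v) = f v) /\
  (forall g g' : {linear tpow -> W},
    (forall v, g (tens v) = g' (tens v)) -> g =1 g').
Proof.
move=> fM; split=> [|g g' gg' t]; last first.
  rewrite [t]tpow_decomp !linear_sum; apply: eq_bigr => h _.
  by rewrite !linearZ gg'.
pose g (t : tpow) := \sum_h t h *: f (bas h).
have gL : linear g.
  move=> a s t; rewrite /g scaler_sumr -big_split; apply: eq_bigr => h _.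
  by rewrite /= !ffunE scalerDl scalerA.
pose gl : {linear tpow -> W} := HB.pack g (GRing.isLinear.Build _ _ _ _ g gL).
exists gl; apply: multilinear_ext => // [v i a u w|h].
  by rewrite tens_multilinear linearP.
rewrite /= /g tens_bas (bigD1 h) //= ffunE eqxx scale1r big1 ?addr0 // => h' hh.
by rewrite ffunE (negPf hh) scale0r.
Qed.

End TensorPower.

Section LambdaS2.
Variables (k : fieldType) (V : vectType k) (n : nat).

(* Indices are shifted by one: pairs 0 <= i < j < n. *)
Definition pairs : Type := {p : 'I_n * 'I_n | p.1 < p.2}%N.

HB.instance Definition _ := Finite.on pairs.

Definition pair_of (i j : 'I_n) (lt_ij : (i < j)%N) : pairs :=
  exist (fun p : 'I_n * 'I_n => p.1 < p.2)%N (i, j) lt_ij.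

Lemma card_pairs : #|{: pairs}| = (n * n.-1)./2.
Proof.
rewrite card_sig -sum1_card -bin2 -triangular_sum big_mkord.
rewrite -(pair_big_dep xpredT (fun i j : 'I_n => (i < j)%N) (fun _ _ => 1%N)) /=.
rewrite (exchange_big_dep xpredT) //=; apply: eq_bigr => j _.
rewrite (big_ord_narrow (F := fun=> 1%N) (ltnW (ltn_ord j))).
by rewrite sum1_card card_ord.
Qed.

Definition TS2 : Type := tpow V pairs.

HB.instance Definition _ := Vector.on TS2.

Lemma dim_TS2 : \dim {: TS2} = (\dim {: V} ^ (n * n.-1)./2)%N.
Proof. by rewrite -card_pairs; exact: dim_tpow. Qed.

Definition has_mono_triangle (v : {ffun pairs -> V}) : Prop :=
  exists (x y z : 'I_n) (xy : (x < y)%N) (xz : (x < z)%N) (yz : (y < z)%N),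
    v (pair_of xy) = v (pair_of xz) /\ v (pair_of xz) = v (pair_of yz).

Definition ES2 : {vspace TS2} :=
  generated (fun t : TS2 => exists2 v, has_mono_triangle v & t = tens v).

Definition LambdaS2 : Type := vquot ES2.

HB.instance Definition _ := Vector.on LambdaS2.

End LambdaS2.

(* Main.v *)
Require Import Defs.
From mathcomp Require Import all_boot all_algebra.
From mathcomp Require Import zify ring.

(** It suffices to find a multilinear form on the families of vectors indexed
    by the edges of the complete graph on [2d] vertices that vanishes on
    families with a monochromatic triangle but not on all families: it factors
    through [TS2], its kernel there contains [ES2], and so [ES2] is proper.

    The form is a determinant. Think of edge weights [l] solving, at each
    vertex [u], the vector equation
      [\sum_(p edge) +/- l p *: v p = 0],
    the sum being over the edges [p] at [u], with sign [+] if [p] starts at [u]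
    and [-] if it ends there. If [v] is constant on a triangle [x < y < z] then
    weights [1, -1, 1] on [xy], [xz], [yz] give a nonzero solution. The vertex
    equations add up to zero, so of their [2d * d] coordinates only
    [(2d - 1) * d] are independent, as many as there are edges: a suitable
    choice of coordinates makes a square system, whose determinant is the form
    ([edge_form]).

    The choice of coordinates comes from a decomposition of the complete graph
    into [d] spanning trees, indexed by the coordinates of [V]. Once each tree
    is rooted, an edge [q] of tree [c] is determined by its endpoint [w] farther
    from the root, and the coordinate [c] of the equation at [w] is assigned to
    it; only coordinate [c] at the root of each tree [c] is left over. If [v p] is the basis
    vector of index the tree of [p], then the matrix falls into one block
    per tree, and this block is triangular with [+/- 1] on the diagonal when
    edges are sorted by height ([child_height]), so the form does not vanish.

    The trees are double stars. The vertices are matched as [{2c, 2c + 1}];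
    tree [c] consists of the edge between [2c] and [2c + 1] and of one leaf edge
    for every other vertex. The four edges between [{2c, 2c + 1}] and
    [{2c', 2c' + 1}], where [c < c'], are shared: the two that preserve parity
    hang [2c'] and [2c' + 1] in tree [c], and the two that change parity hang
    [2c] and [2c + 1] in tree [c']. *)

Set Implicit Arguments.
Unset Strict Implicit.
Unset Printing Implicit Defensive.

Import GRing.Theory.
Local Open Scope ring_scope.

(** * Determinants indexed by a finite type *)

Section FinDet.
Variables (F : fieldType) (T : finType).
Implicit Types A : T -> T -> F.

(** Rows and columns share the enumeration of [T], so the sign of the
    determinant is independent of its order: this lets edges index both the
    unknowns and the equations without being numbered. *)
Definition fin_det A : F :=
  \det (\matrix_(i, j) A (enum_val i) (enum_val j) : 'M_#|T|).

Lemma fin_det_row_linear A B C (p : T) (a : F) :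
  (forall q, A p q = a * B p q + C p q) ->
  (forall p' q, p' != p -> A p' q = B p' q) ->
  (forall p' q, p' != p -> A p' q = C p' q) ->
  fin_det A = a * fin_det B + fin_det C.
Proof.
move=> Ap AB AC; rewrite -[fin_det C]mul1r.
apply: (determinant_multilinear (i0 := enum_rank p)).
- by apply/rowP=> j; rewrite !mxE enum_rankK mul1r Ap.
- apply/matrixP=> i j; rewrite !mxE AB //.
  by rewrite -(inj_eq enum_rank_inj) enum_valK eq_sym neq_lift.
- apply/matrixP=> i j; rewrite !mxE AC //.
  by rewrite -(inj_eq enum_rank_inj) enum_valK eq_sym neq_lift.
Qed.

(** Changing one vector of the family changes a single row. *)
Lemma fin_det_multilinear (V : vectType F) (c : V -> T -> T -> F) :
  (forall a u w p q, c (a *: u + w) p q = a * c u p q + c w p q) ->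
  multilinear (fun v : {ffun T -> V} => fin_det (fun p => c (v p) p) : F^o).
Proof.
move=> cL v p a u w.
apply: (fin_det_row_linear (p := p)) => [q|p' q|p' q]; rewrite !ffunE.
- by rewrite eqxx cL.
- by move=> /negPf->.
- by move=> /negPf->.
Qed.

Lemma fin_det0P A :
  reflect (exists2 u : T -> F, exists p, u p != 0 &
             forall q, \sum_p u p * A p q = 0)
          (fin_det A == 0).
Proof.
have sum_enum (G : T -> F) : \sum_p G p = \sum_(i < #|T|) G (enum_val i).
  by rewrite (reindex (@enum_val T T)) //; apply/onW_bij/enum_val_bij.
apply: (iffP det0P) => [[u u0 uA]|[u [p up] uA]].
  exists (fun p => u 0 (enum_rank p)) => [|q].
    have /rV0Pn[i ui] := u0.
    by exists (enum_val i); rewrite enum_valK.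
  have := congr1 (fun B : 'rV_ _ => B 0 (enum_rank q)) uA; rewrite !mxE.
  move=> uAq; rewrite sum_enum -[RHS]uAq.
  by apply: eq_bigr => i _; rewrite mxE enum_rankK enum_valK.
exists (\row_i u (enum_val i)).
  by apply/rV0Pn; exists (enum_rank p); rewrite mxE enum_rankK.
apply/rowP=> j; rewrite !mxE -[RHS](uA (enum_val j)) sum_enum.
by apply: eq_bigr => i _; rewrite !mxE.
Qed.

(** Listing the indices by increasing [r] makes the matrix triangular; instead
    of reordering, a kernel vector is shown to vanish by induction on [r]. *)
Lemma fin_det_neq0_rank A (r : T -> nat) :
  (forall p, A p p != 0) ->
  (forall p q, p != q -> A p q != 0 -> (r p < r q)%N) ->
  fin_det A != 0.
Proof.
move=> Add Aoff; apply/fin_det0P => -[u [p0 /eqP up0] uA]; apply: up0.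
suff H m : forall q, (r q < m)%N -> u q = 0 by apply: (H (r p0).+1).
elim: m => // m IHm q rq.
have := uA q; rewrite (bigD1 q) //= big1 => [/eqP|p pq].
  by rewrite addr0 mulf_eq0 (negPf (Add q)) orbF => /eqP.
have [->|Apq] := eqVneq (A p q) 0; first by rewrite mulr0.
by rewrite IHm ?mul0r //; apply: leq_trans (Aoff _ _ pq Apq) _.
Qed.

End FinDet.

(** * Reduction to a multilinear form *)

Lemma dim_vquot_gt0 (k : fieldType) (V : vectType k) (U : {vspace V}) (v : V) :
  v \notin U -> (0 < \dim {: vquot U})%N.
Proof.
move=> vU; rewrite lt0n; apply: contra vU => /eqP q0.
have := dim_vquot U; rewrite q0 add0n => dimU.
suff -> : U = fullv by rewrite memvf.
by apply/eqP; rewrite eqEdim subvf dimU /=.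
Qed.

(** By the universal property a multilinear form is a linear form on tensors,
    whose kernel contains [ES2] as soon as it contains the generators. *)
Lemma tens_notin_ES2 (k : fieldType) (V : vectType k) (n : nat)
    (f : {ffun pairs n -> V} -> k^o) (v0 : {ffun pairs n -> V}) :
  multilinear f -> (forall v, has_mono_triangle v -> f v = 0) ->
  f v0 != 0 -> tens v0 \notin ES2 V n.
Proof.
move=> fM f0 fv0; have [[g gf] _] := tens_universal fM.
have [_ minE] := generatedP (fun t : TS2 V n =>
  exists2 v, has_mono_triangle v & t = tens v).
have lin0 t : (t \in lker (linfun (g : {linear TS2 V n -> k^o}))) = (g t == 0).
  by rewrite memv_ker lfunE.
apply: contra fv0 => /(subvP (minE (lker (linfun g)) _)) h.
rewrite -gf -lin0; apply: h => _ [v vT ->].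
by rewrite lin0 gf f0.
Qed.

(** * The decomposition into double stars *)

Section DoubleStars.
Variable d : nat.
Implicit Types p q : pairs (2 * d).

Notation tl p := (val p).1.
Notation hd p := (val p).2.

Definition same_parity p := odd (tl p) == odd (hd p).

(** The index of the tree containing [p]. Two vertices that are matched to each
    other have different parities and give the same value in both branches. *)
Definition tree p : nat := if same_parity p then (tl p)./2 else (hd p)./2.

Definition central_edge p : bool := (tl p)./2 == (hd p)./2.

(** The endpoint of [p] farther from the root, [2c] being the root of
    tree [c]. *)
Definition child p : 'I_(2 * d) :=
  if ~~ same_parity p && ~~ central_edge p then tl p else hd p.

Lemma tree_lt p : (tree p < d)%N.
Proof. by rewrite /tree; case: ifP => _; case: p => -[[i Hi] [j Hj]] /= *; lia. Qed.

(** An edge [p] of a rooted tree containing the lower end of another edge [q]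
    is below [q]. In a double star, [q] must then be the central edge, and [p] a
    leaf edge, so the boolean [central_edge] serves as the height of an edge. *)
Lemma child_height p q :
  tree p = tree q -> (child q == tl p) || (child q == hd p) -> p != q ->
  (central_edge p < central_edge q)%N.
Proof.
rewrite -(inj_eq val_inj p) /tree /child /central_edge /same_parity.
case: p q => [[[i Hi] [j Hj]] /= ij] [[[x Hx] [y Hy]] /= xy].
rewrite xpair_eqE -!val_eqE /= => T; rewrite (fun_if val) /=; move: T.
by case: ifP => ?; case: ifP => ? /=; do ?case: ifP => ?; lia.
Qed.

End DoubleStars.

(** * The determinant *)

Section EdgeForm.
Variables (k : fieldType) (V : vectType k).
Notation d := (\dim {: V}).
Notation n := (2 * d)%N.

Definition incidence (p : pairs n) (u : 'I_n) : k :=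
  (u == (val p).1)%:R - (u == (val p).2)%:R.

Lemma incidence_child (p : pairs n) : incidence p (child p) != 0.
Proof.
case: p => -[i j] ij; rewrite /incidence /child /=.
have /negPf neq_ij : i != j by rewrite -val_eqE /= neq_ltn (ij : (i < j)%N).
case: ifP => _; rewrite eqxx; first by rewrite neq_ij subr0 oner_neq0.
by rewrite (eq_sym j) neq_ij sub0r oppr_eq0 oner_neq0.
Qed.

Definition tree_ord (p : pairs n) : 'I_d := Ordinal (tree_lt p).

(** The coefficient of the weight of [p] in the scalar equation assigned to [q]
    if the edge [p] carries the vector [x]. *)
Definition edge_coef (x : V) (p q : pairs n) : k :=
  coord (vbasis {: V}) (tree_ord q) x * incidence p (child q).

Definition edge_form (v : {ffun pairs n -> V}) : k^o :=
  fin_det (fun p => edge_coef (v p) p).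

Lemma edge_form_multilinear : multilinear edge_form.
Proof.
apply: fin_det_multilinear => a u w p q.
by rewrite /edge_coef linearP mulrDl -mulrA.
Qed.

(** The incidence vectors of the edges [xy] and [yz] add up to that of [xz], so
    equal vectors on these edges make three rows dependent. *)
Lemma edge_form_triangle v : has_mono_triangle v -> edge_form v = 0.
Proof.
move=> [x [y [z [xy [xz [yz [vxy vxz]]]]]]]; apply/eqP/fin_det0P.
pose e (p q : pairs n) : k := (q == p)%:R.
have sum_e p G : \sum_q e p q * G q = G p.
  rewrite (bigD1 p) //= /e eqxx mul1r big1 ?addr0 // => q /negPf->.
  by rewrite mul0r.
exists (fun p => e (pair_of xy) p - e (pair_of xz) p + e (pair_of yz) p) => [|q].
  exists (pair_of xy).
  rewrite /e -!(inj_eq val_inj) /= !xpair_eqE !eqxx /= -!val_eqE /=.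
  by rewrite (ltn_eqF xy) (ltn_eqF yz) /= subr0 addr0 oner_neq0.
under eq_bigr do rewrite mulrDl mulrBl.
rewrite big_split /= sumrB !sum_e /edge_coef vxy vxz /incidence /=.
ring.
Qed.

Definition tree_family : {ffun pairs n -> V} :=
  [ffun p => (vbasis {: V})`_(tree_ord p)].

Lemma edge_form_tree_family : edge_form tree_family != 0.
Proof.
have coefE p q : edge_coef (tree_family p) p q =
    (tree_ord p == tree_ord q)%:R * incidence p (child q).
  by rewrite /edge_coef ffunE coord_free // (basis_free (vbasisP _)).
apply: (fin_det_neq0_rank (r := fun p => central_edge p)) => [p|p q pq].
  by rewrite coefE eqxx mul1r incidence_child.
rewrite coefE mulf_eq0 negb_or => /andP[].
case: (tree_ord p =P tree_ord q) => [[treeE] _|_]; last by rewrite eqxx.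
move=> inc; apply: child_height => //.
by apply: contraR inc; rewrite negb_or /incidence => /andP[/negPf-> /negPf->];
  rewrite subrr.
Qed.

End EdgeForm.

Theorem corollary3p8 (k : fieldType) (d : nat) (V : vectType k)
    (hd : (2 <= d)%N) (hV : \dim {: V} = d) :
  (1 <= \dim {: LambdaS2 V (2 * d)})%N.
Proof.
move: hd; subst d => _.
apply: dim_vquot_gt0.
exact: tens_notin_ES2 (@edge_form_multilinear k V) (@edge_form_triangle k V)
  (edge_form_tree_family V).
Qed.
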